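(* Let $n_x\ge 1$, $p\ge n_x$, $n=n_x+p+1$, and let $\hat g_0,\dots,\hat g_{n-1}\in\mathbb{R}$ be (estimated) Markov parameters with associated Hankel matrix $\hat{\mathcal H}_{n_xp}\in\mathbb{R}^{(n_x+1)\times(p+1)}$, whose $(i,j)$ entry is $\hat g_{i+j-2}$. Let $\hat\sigma_1\ge\dots\ge\hat\sigma_{n_x+1}\ge 0$ be its singular values, and assume that $\hat\sigma_{n_x}>\hat\sigma_{n_x+1}$ and that the total least-squares estimate $\hat{\bm a}_{\mathrm{tls}}$ defined in the context exists. Let $\hat A_{\mathrm{tls}}\in\mathbb{R}^{n_x\times n_x}$ be the observer-canonical-form matrix built from $\hat{\bm a}_{\mathrm{tls}}$, and let $\hat A_R\in\mathbb{R}^{n_x\times n_x}$ be the range-space-based (SVD-based) estimate, both as defined in the context. Then $\hat A_{\mathrm{tls}}$ and $\hat A_R$ are similar: there exists an invertible matrix $T\in\mathbb{R}^{n_x\times n_x}$ such that $\hat A_{\mathrm{tls}}=T^{-1}\hat A_R T$.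
   Context: Partition $\hat{\mathcal H}_{n_xp}=\begin{bmatrix}\hat{\mathcal H}_{n_xp}^{+}\\ \hat{\mathcal H}_{n_xp}^{-}\end{bmatrix}$, where $\hat{\mathcal H}_{n_xp}^{+}\in\mathbb{R}^{n_x\times(p+1)}$ consists of the first $n_x$ rows and $\hat{\mathcal H}_{n_xp}^{-}\in\mathbb{R}^{1\times(p+1)}$ is the last row. Let $\hat{\mathcal H}_{n_xp}=\hat U\hat S\hat V^\top$ be a singular value decomposition with $\hat U=[\hat u_1\ \cdots\ \hat u_{n_x+1}]\in\mathbb{R}^{(n_x+1)\times(n_x+1)}$ and $\hat V\in\mathbb{R}^{(p+1)\times(p+1)}$ orthogonal and $\hat S=[\mathrm{diag}(\hat\sigma_1,\dots,\hat\sigma_{n_x+1})\ \ 0]\in\mathbb{R}^{(n_x+1)\times(p+1)}$. Total least-squares (TLS) estimate: the row vector $\hat{\bm a}_{\mathrm{tls}}=[\hat a_{n_x}\ \hat a_{n_x-1}\ \cdots\ \hat a_1]$ given by $$\hat{\bm a}_{\mathrm{tls}}^\top=\hat u_{n_x+1,1:n_x}\,\hat u_{n_x+1,n_x+1}^{-1},$$ where $\hat u_{n_x+1,1:n_x}$ is the vector of the first $n_x$ entries of $\hat u_{n_x+1}$ and $\hat u_{n_x+1,n_x+1}$ is its last entry; equivalently, $$\hat{\bm a}_{\mathrm{tls}}^\top=-\left(\hat{\mathcal H}_{n_xp}^{+}(\hat{\mathcal H}_{n_xp}^{+})^\top-\hat\sigma_{n_x+1}^2I\right)^{-1}\hat{\mathcal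 H}_{n_xp}^{+}(\hat{\mathcal H}_{n_xp}^{-})^\top .$$ That it exists means that the inverses in these formulas exist (in particular $\hat u_{n_x+1,n_x+1}\neq 0$). The matrix $\hat A_{\mathrm{tls}}$ is the companion (observer canonical form) matrix $$\hat A_{\mathrm{tls}}=\begin{bmatrix}-\hat a_1&1&0&\cdots&0\\-\hat a_2&0&1&\cdots&0\\ \vdots&\vdots&\vdots&\ddots&\vdots\\ -\hat a_{n_x-1}&0&0&\cdots&1\\ -\hat a_{n_x}&0&0&\cdots&0\end{bmatrix}.$$ Range-space-based estimate: let $\hat U_1=[\hat u_1\ \cdots\ \hat u_{n_x}]$, $\hat S_1=\mathrm{diag}(\hat\sigma_1,\dots,\hat\sigma_{n_x})$ and $\hat{\mathcal O}_{n_x}=\hat U_1\hat S_1^{1/2}\in\mathbb{R}^{(n_x+1)\times n_x}$. Let $\hat{\mathcal O}_{n_x}^{+}$ and $\hat{\mathcal O}_{n_x}^{-}$ be the first $n_x$ rows and the last $n_x$ rows of $\hat{\mathcal O}_{n_x}$, respectively. Then $$\hat A_R=\left((\hat{\mathcal O}_{n_x}^{+})^\top\hat{\mathcal O}_{n_x}^{+}\right)^{-1}(\hat{\mathcal O}_{n_x}^{+})^\top\hat{\mathcal O}_{n_x}^{-}.$$ *)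

(* Defs.v *)
From HB Require Import structures.
From mathcomp Require Import all_boot all_order all_algebra.
From mathcomp Require Import reals.
Set Implicit Arguments.
Unset Strict Implicit.
Unset Printing Implicit Defensive.
Import Order.TTheory GRing.Theory Num.Theory.
Local Open Scope ring_scope.

(* Matrices with nx + 1 rows have row type 'I_nx.+1.  All indices are
   zero-based: the ordinal ord_max is the last, (nx + 1)-st index, and
   [row' ord_max A], [row' ord0 A], [col' ord_max A] are the first nx rows,
   the last nx rows and the first nx columns of A. *)

(* Only g_0, ..., g_{nx + p} are used. *)
Definition hankel (R : realType) (nx p : nat) (g : seq R) :
    'M[R]_(nx.+1, p.+1) :=
  \matrix_(i, j) g`_(i + j).

Definition orthogonal_mx (R : realType) (m : nat) (Q : 'M[R]_m) : Prop :=
  Q^T *m Q = 1%:M /\ Q *m Q^T = 1%:M.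

(* The rectangular matrix [diag(s) 0]. *)
Definition rdiag_mx (R : realType) (m n : nat) (s : 'rV[R]_m) : 'M[R]_(m, n) :=
  \matrix_(i, j) (if (i : nat) == j then s 0 i else 0).

(* Singular value decomposition of a matrix with at least as many columns as
   rows; the entries of s are then all the singular values of A. *)
Definition is_svd (R : realType) (m n : nat) (A : 'M[R]_(m, n))
    (U : 'M[R]_m) (s : 'rV[R]_m) (V : 'M[R]_n) : Prop :=
  [/\ orthogonal_mx U, orthogonal_mx V,
      forall i : 'I_m, 0 <= s 0 i,
      forall i j : 'I_m, (i <= j)%N -> s 0 j <= s 0 i &
      A = U *m rdiag_mx n s *m V^T].

(* The two inverses occurring in the two formulas for the TLS estimate. *)
Definition tls_exists (R : realType) (nx p : nat) (H : 'M[R]_(nx.+1, p.+1))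
    (U : 'M[R]_nx.+1) (s : 'rV[R]_nx.+1) : Prop :=
  U ord_max ord_max != 0 /\
  row' ord_max H *m (row' ord_max H)^T - (s 0 ord_max ^+ 2)%:M \in unitmx.

(* The row vector [a_nx, ..., a_1]: entry j (zero-based) is a_{nx - j}. *)
Definition a_tls (R : realType) (nx : nat) (U : 'M[R]_nx.+1) : 'rV[R]_nx :=
  (U ord_max ord_max)^-1 *: (row' ord_max (col ord_max U))^T.

(* Since a = [a_nx, ..., a_1], the coefficient a_{i + 1} placed in (zero-based)
   row i of the first column is a 0 (rev_ord i). *)
Definition observer_mx (R : realType) (nx : nat) (a : 'rV[R]_nx) : 'M[R]_nx :=
  \matrix_(i, j) (if (j : nat) == 0%N then - a 0 (rev_ord i)
                  else if (j : nat) == i.+1 then 1 else 0).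

Definition A_tls (R : realType) (nx : nat) (U : 'M[R]_nx.+1) : 'M[R]_nx :=
  observer_mx (a_tls U).

Definition obs_mx (R : realType) (nx : nat) (U : 'M[R]_nx.+1)
    (s : 'rV[R]_nx.+1) : 'M[R]_(nx.+1, nx) :=
  col' ord_max U *m diag_mx (map_mx Num.sqrt (col' ord_max s)).

(* invmx M is M itself when M is singular; under the hypotheses of the theorem
   the Gram matrix inverted here is always invertible. *)
Definition A_range (R : realType) (nx : nat) (U : 'M[R]_nx.+1)
    (s : 'rV[R]_nx.+1) : 'M[R]_nx :=
  let Oplus : 'M[R]_nx := row' ord_max (obs_mx U s) in
  let Ominus : 'M[R]_nx := row' ord0 (obs_mx U s) in
  invmx (Oplus^T *m Oplus) *m Oplus^T *m Ominus.

(* Main.v *)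
Require Import Defs.
From HB Require Import structures.
From mathcomp Require Import all_boot all_order all_algebra.
From mathcomp Require Import reals zify.
Set Implicit Arguments.
Unset Strict Implicit.
Unset Printing Implicit Defensive.
Import Order.TTheory GRing.Theory Num.Theory.
Local Open Scope ring_scope.

(** The last column u of U is orthogonal to the columns of the extended
    observability matrix O.  Solving u^T O = 0 for the last row of O gives
    O^- = M O^+, where M is the companion matrix whose last row is -a_tls, and
    O^+ is invertible because its determinant is a positive multiple of a minor
    of U that equals, up to sign, the corresponding entry of U^T.  Hence
    A_R = (O^+)^-1 M O^+.  Finally M is conjugate to the observer form by the
    unitriangular Toeplitz matrix of the coefficients of the characteristic
    polynomial. *)

(** [F] lives on [nat] so that [m] may fall outside the range, as the shifted index [i.+1] does in a
    last row. *)
Lemma sum_ord_delta (R : pzSemiRingType) (n m : nat) (F : nat -> R) :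
  \sum_(k < n) ((k : nat) == m)%:R * F k = (m < n)%:R * F m.
Proof.
case: (ltnP m n) => [lt_mn | le_nm].
  rewrite (bigD1 (Ordinal lt_mn)) //= eqxx big1 ?addr0 // => k.
  by rewrite -val_eqE /= => /negbTE->; rewrite mul0r.
rewrite mul0r big1 // => k _; rewrite ltn_eqF ?mul0r //.
exact: leq_trans (ltn_ord k) le_nm.
Qed.

(** For [a = [a_n, ..., a_1]] this is X^n + a_1 X^(n-1) + ... + a_n, the characteristic polynomial
    of both companion matrices. *)
Definition monic_of_row (R : nzRingType) (n : nat) (a : 'rV[R]_n) : {poly R} :=
  'X^n + rVpoly a.

Definition last_row_companion (R : nzRingType) (n : nat) (a : 'rV[R]_n) :
    'M[R]_n :=
  \matrix_(i, j) (((j : nat) == i.+1)%:R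
                  - ((i : nat) == n.-1)%:R * (monic_of_row a)`_j).

(* Since i < n, the subtraction n + j - i is never truncated. *)
Definition coef_toeplitz (R : nzRingType) (n : nat) (a : 'rV[R]_n) : 'M[R]_n :=
  \matrix_(i, j) (monic_of_row a)`_(n + j - i).

Lemma coef_monic_of_row_ord (R : nzRingType) (n : nat) (a : 'rV[R]_n)
    (i : 'I_n) :
  (monic_of_row a)`_i = a 0 i.
Proof. by rewrite coefD coefXn coef_rVpoly_ord ltn_eqF ?add0r. Qed.

Lemma coef_monic_of_row_ge (R : nzRingType) (n : nat) (a : 'rV[R]_n)
    (k : nat) :
  (n <= k)%N -> (monic_of_row a)`_k = (k == n)%:R.
Proof.
move=> le_nk; rewrite coefD coefXn [X in _ + X]nth_default ?addr0 //.
exact: leq_trans (size_poly _ _) le_nk.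
Qed.

(** Above the diagonal the indices exceed the degree [n]; the diagonal carries the leading
    coefficient 1. *)
Lemma coef_toeplitz_unit (R : comUnitRingType) (n : nat) (a : 'rV[R]_n) :
  coef_toeplitz a \in unitmx.
Proof.
rewrite unitmxE det_trig; last first.
  apply/is_trig_mxP => i j lt_ij; rewrite mxE coef_monic_of_row_ge; last by lia.
  by rewrite gtn_eqF //; lia.
by rewrite big1 ?unitr1 // => i _; rewrite mxE addnK coef_monic_of_row_ge // eqxx.
Qed.

(** Away from column 0 and the last row, both entries are the coefficient of index [n + j - i.+1].
    On these two lines both vanish, one side by cancellation, except in their common corner, where
    both are minus the constant coefficient. *)
Lemma observer_mx_toeplitz (R : realType) (n : nat) (a : 'rV[R]_n) :
  observer_mx a *m coef_toeplitz a = coef_toeplitz a *m last_row_companion a.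
Proof.
set P := monic_of_row a.
apply/matrixP => i j; rewrite !mxE.
under eq_bigr => k _.
  rewrite !mxE -coef_monic_of_row_ord -/P /=.
  rewrite (_ : (if _ then _ else _) =
    ((k : nat) == 0)%:R * - P`_(n - i.+1) + ((k : nat) == i.+1)%:R); last first.
    by case: eqP => [->|_]; case: eqP; rewrite ?mul1r ?mul0r ?addr0 ?add0r.
  rewrite mulrDl -mulrA; over.
rewrite big_split /=.
rewrite (sum_ord_delta n 0 (fun k => - P`_(n - i.+1) * P`_(n + j - k))).
rewrite (sum_ord_delta n i.+1 (fun k => P`_(n + j - k))).
under [RHS]eq_bigr => k _.
  rewrite !mxE -/P mulrBr mulrA.
  (* At [j = 0] the truncated [j.-1] would select a spurious term; the factor [0 < j] removes it. *)
  rewrite (_ : P`_(n + k - i) * ((j : nat) == k.+1)%:R =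
     ((k : nat) == j.-1)%:R * (((0 < j)%N)%:R * P`_(n + k - i))); last first.
    case: (nat_of_ord j) => [|j'] /=; first by rewrite mul0r !mulr0.
    by rewrite eqSS eq_sym mul1r mulr_natr mulr_natl.
  rewrite [P`_(n + k - i) * (_ == n.-1)%:R]mulrC -mulrA; over.
rewrite sumrB.
rewrite (sum_ord_delta n j.-1 (fun k => ((0 < j)%N)%:R * P`_(n + k - i))).
rewrite (sum_ord_delta n n.-1 (fun k => P`_(n + k - i) * P`_j)).
have lt_in := ltn_ord i; have lt_jn := ltn_ord j.
have n_gt0 : (0 < n)%N by lia.
have -> : (n.-1 < n)%N by lia.
have -> : (j.-1 < n)%N by lia.
rewrite n_gt0 !mul1r subn0 (coef_monic_of_row_ge a (leq_addr j n)).
rewrite (coef_monic_of_row_ge a (_ : n <= n + n.-1 - i)%N); last by lia.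
have -> : (n + j == n)%N = (j == 0 :> nat)%N by lia.
have -> : (n + n.-1 - i == n)%N = (i == n.-1 :> nat)%N by lia.
have [j0 | j_neq0] := eqVneq (j : nat) 0%N.
  rewrite j0 addn0 ltnn mul0r sub0r mulr1.
  have [-> | i_neq] := eqVneq (i : nat) n.-1.
    by rewrite prednK // ltnn mul0r addr0 mul1r subnn.
  have -> : (i.+1 < n)%N by lia.
  by rewrite mul1r mul0r addNr oppr0.
have -> : (0 < j)%N by lia.
rewrite mulr0 add0r mul1r.
have -> : (n + j.-1 - i = n + j - i.+1)%N by lia.
have [-> | i_neq] := eqVneq (i : nat) n.-1.
  rewrite prednK // ltnn mul0r mul1r.
  by rewrite [(n + j)%N]addnC addnK subrr.
have -> : (i.+1 < n)%N by lia.
by rewrite mul1r mul0r subr0.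
Qed.

(** All rows but the last are a pure shift; the last one is [w *m O = 0] solved for the bottom row
    of [O]. *)
Lemma row'0_last_row_companion (F : fieldType) (n m : nat)
    (O : 'M[F]_(n.+1, m)) (w : 'rV[F]_n.+1) :
    w 0 ord_max != 0 -> w *m O = 0 ->
  row' ord0 O
    = last_row_companion ((w 0 ord_max)^-1 *: col' ord_max w) *m row' ord_max O.
Proof.
move=> w_neq0 wO0; set a := _ *: _.
apply/matrixP => i j; rewrite !mxE.
pose f k := O (inord k) j.
have fE (k : 'I_n.+1) : O k j = f k by rewrite /f inord_val.
under eq_bigr => k _.
  rewrite !mxE coef_monic_of_row_ord fE lift_max mulrBl -mulrA; over.
rewrite sumrB (sum_ord_delta n i.+1 f) -mulr_sumr fE lift0.
have [i_last | i_neq] := eqVneq (i : nat) n.-1; last first.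
  have -> : (i.+1 < n)%N by have := ltn_ord i; lia.
  by rewrite mul1r mul0r subr0.
have iS : i.+1 = n by have := ltn_ord i; lia.
rewrite iS ltnn mul0r mul1r sub0r.
move/matrixP/(_ 0 j): wO0; rewrite !mxE (bigD1_ord ord_max) //= fE /=.
move/eqP; rewrite addr_eq0 => /eqP wf.
apply: (mulfI w_neq0); rewrite wf mulrN mulr_sumr; congr (- _).
by apply: eq_bigr => k _; rewrite !mxE fE lift_max mulrA mulVKf.
Qed.

(** Since the inverse of [Q] is [Q^T], its adjugate is [\det Q *: Q^T], so the minor is
    [\det Q * Q i j] up to sign. *)
Lemma orthogonal_minor_unit (R : realType) (n : nat) (Q : 'M[R]_n.+1) i j :
    orthogonal_mx Q -> Q i j != 0 -> row' i (col' j Q) \in unitmx.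
Proof.
move=> [QtQ QQt] Qij; rewrite unitmxE unitfE.
have detQ : \det Q != 0.
  by have [Qu _] := mulmx1_unit QQt; rewrite -unitfE -unitmxE.
have adjQ : \adj Q = \det Q *: Q^T.
  by rewrite -[LHS]mul1mx -QtQ -mulmxA mul_mx_adj mul_mx_scalar.
move/matrixP/(_ j i): adjQ; rewrite !mxE /cofactor => eq_minor.
apply: contraTneq (mulf_neq0 detQ Qij) => minor0.
by rewrite -eq_minor minor0 mulr0 eqxx.
Qed.

Lemma last_col_obs_mx (R : realType) (n : nat) (U : 'M[R]_n.+1)
    (s : 'rV[R]_n.+1) :
  orthogonal_mx U -> (col ord_max U)^T *m obs_mx U s = 0.
Proof.
move=> [UtU _]; rewrite /obs_mx mulmxA.
suff -> : (col ord_max U)^T *m col' ord_max U = 0 by rewrite mul0mx.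
apply/matrixP => i j; move/matrixP/(_ ord_max (lift ord_max j)): UtU.
rewrite !mxE (negbTE (neq_lift _ _)) => utUj; rewrite -[RHS]utUj.
by apply: eq_bigr => k _; rewrite !mxE.
Qed.

Lemma obs_mx_plus_unit (R : realType) (n : nat) (U : 'M[R]_n.+1)
    (s : 'rV[R]_n.+1) :
    orthogonal_mx U -> U ord_max ord_max != 0 ->
    (forall j : 'I_n, 0 < s 0 (lift ord_max j)) ->
  row' ord_max (obs_mx U s) \in unitmx.
Proof.
move=> Uorth Umax s_gt0.
have -> : row' ord_max (obs_mx U s)
    = row' ord_max (col' ord_max U) *m diag_mx (map_mx Num.sqrt (col' ord_max s)).
  apply/matrixP => i j; rewrite !mxE.
  by apply: eq_bigr => k _; rewrite !mxE.
rewrite unitmx_mul orthogonal_minor_unit //= unitmxE det_diag unitfE.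
by apply/prodf_neq0 => j _; rewrite !mxE gt_eqF // sqrtr_gt0.
Qed.

(** The least-squares pseudo-inverse of an invertible square matrix is its inverse. *)
Lemma invmx_gram_mul (R : comUnitRingType) (n : nat) (A B : 'M[R]_n) :
  A \in unitmx -> invmx (A^T *m A) *m A^T *m B = invmx A *m B.
Proof.
move=> Au; have Gu : A^T *m A \in unitmx by rewrite unitmx_mul unitmx_tr Au.
congr (_ *m B); apply: (can_inj (mulKmx Gu)).
by rewrite mulmxA mulmxV // mul1mx -mulmxA mulmxV // mulmx1.
Qed.

Theorem mainTheorem1 (R : realType) (nx p n : nat)
    (hnx : (1 <= nx)%N) (hp : (nx <= p)%N) (hn : n = (nx + p + 1)%N)
    (g : n.-tuple R)
    (U : 'M[R]_nx.+1) (s : 'rV[R]_nx.+1) (V : 'M[R]_p.+1)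
    (hsvd : is_svd (hankel nx p g) U s V)
    (hgap : s 0 ord_max < s 0 (inord nx.-1))
    (htls : tls_exists (hankel nx p g) U s) :
  exists T : 'M[R]_nx,
    T \in unitmx /\ A_tls U = invmx T *m A_range U s *m T.
Proof.
case: hsvd => Uorth _ s_ge0 s_anti _; case: htls => Umax _.
have s_gt0 (j : 'I_nx) : 0 < s 0 (lift ord_max j).
  (* The spectral gap makes the first [nx] singular values positive, since the last one is
     nonnegative. *)
  apply: le_lt_trans (s_ge0 ord_max) (lt_le_trans hgap _).
  by apply: s_anti; rewrite lift_max inordK; have := ltn_ord j; lia.
have Ou := obs_mx_plus_unit Uorth Umax s_gt0.
set a := a_tls U; set Op := row' ord_max (obs_mx U s) in Ou.
have Lu := coef_toeplitz_unit a.
have Om : row' ord0 (obs_mx U s) = last_row_companion a *m Op.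
  have -> : a = ((col ord_max U)^T 0 ord_max)^-1 *: col' ord_max (col ord_max U)^T.
    by apply/matrixP => i j; rewrite !mxE.
  by apply: row'0_last_row_companion; rewrite ?mxE // last_col_obs_mx.
(* With L the Toeplitz matrix and M the companion matrix, [A_tls U] is L M L^-1 and [A_range U s] is
   [Op]^-1 M [Op], whence T^-1 = L [Op]. *)
exists (invmx (coef_toeplitz a *m Op)).
have LOu : coef_toeplitz a *m Op \in unitmx by rewrite unitmx_mul Lu Ou.
split; first by rewrite unitmx_inv.
rewrite /A_range invmx_gram_mul // Om invmxK.
apply: (can_inj (mulmxK LOu)); rewrite mulmxKV //.
rewrite -!mulmxA [Op *m _]mulmxA mulmxV // mul1mx.
by rewrite !mulmxA observer_mx_toeplitz.
Qed.
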